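(* Let $X_m(t)=\mathcal{V}_mY_m(t)\mathcal{V}_m^T$, $t\in[0,t_f]$, be the Krylov-based approximate solution after $m$ iterations to the differential Riccati equation $$\dot X(t)=A^TX(t)+X(t)A-X(t)BB^TX(t)+C^TC,\qquad X(0)=ZZ^T,$$ where $Y_m(t)$ is a differentiable symmetric $d\times d$ matrix function that approximately (not necessarily exactly) solves the reduced problem $$\dot Y_m=\mathcal{T}_m^TY_m+Y_m\mathcal{T}_m-Y_mB_mB_m^TY_m+C_m^TC_m,\qquad Y_m(0)=Z_mZ_m^T.$$ Define, for $t\in[0,t_f]$, $$\mathcal{R}_m(t)=\dot X_m(t)-A^TX_m(t)-X_m(t)A+X_m(t)BB^TX_m(t)-C^TC,$$ $$R_m^{(I)}(t)=\dot Y_m(t)-\mathcal{T}_m^TY_m(t)-Y_m(t)\mathcal{T}_m+Y_m(t)B_mB_m^TY_m(t)-C_m^TC_m,$$ $$R_m^{(O)}(t)=\tau_m^TY_m(t).$$ Then for every $t\in[0,t_f]$ $$\|\mathcal{R}_m(t)\|_F^2=\|R_m^{(I)}(t)\|_F^2+2\,\|R_m^{(O)}(t)\|_F^2 .$$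
   Context: Data: $A\in\mathbb{R}^{n\times n}$ is nonsingular, and $B\in\mathbb{R}^{n\times s}$, $C\in\mathbb{R}^{p\times n}$, $Z\in\mathbb{R}^{n\times q}$ are constant matrices; $t_f>0$. $\|\cdot\|_F$ is the Frobenius norm. Krylov space: put $N=[C^T,Z]$. The matrix $\mathcal{V}_m\in\mathbb{R}^{n\times d}$ has orthonormal columns spanning one of the following block Krylov subspaces generated by $A^T$ and $N$: polynomial, $\mathcal{K}_m(A^T,N)=\mathrm{range}[N,A^TN,\dots,(A^T)^{m-1}N]$; extended, $\mathcal{K}_m(A^T,N)+\mathcal{K}_m(A^{-T},A^{-T}N)$; or rational, $\mathrm{range}[N,(A^T-s_2I)^{-1}N,\dots,\prod_{i=2}^m(A^T-s_iI)^{-1}N]$ for given shifts $s_2,\dots,s_m$ (not eigenvalues of $A$). In every case $\mathrm{range}(C^T)\subseteq\mathrm{range}(\mathcal{V}_m)$, so $C^T=\mathcal{V}_m\mathcal{V}_m^TC^T$. Reduced data: $\mathcal{T}_m=\mathcal{V}_m^TA\mathcal{V}_m$, $B_m=\mathcal{V}_m^TB$, $Z_m=\mathcal{V}_m^TZ$, $C_m=C\mathcal{V}_m$. Arnoldi-type relation: there are real matrices $\nu_{m+1}$ (with $n$ rows) and $\tau_m$ (with $d$ rows and as many columns as $\nu_{m+1}$) such that $[\mathcal{V}_m,\nu_{m+1}]$ has orthonormal columns and $$A^T\mathcal{V}_m=\mathcal{V}_m\mathcal{T}_m^T+\nu_{m+1}\tau_m^T.$$ These are the $\nu_{m+1}$,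 $\tau_m$ used in the claim. *)

(* Defs.v *)
From HB Require Import structures.
From mathcomp Require Import all_boot all_order all_algebra.
From mathcomp Require Import all_classical all_reals all_analysis.
From mathcomp Require Import complex.
Set Implicit Arguments.
Unset Strict Implicit.
Unset Printing Implicit Defensive.
Import Order.TTheory GRing.Theory Num.Theory.
Import numFieldNormedType.Exports.
Local Open Scope classical_set_scope.
Local Open Scope ring_scope.

Definition frobenius (R : realType) (m n : nat) (M : 'M[R]_(m, n)) : R :=
  Num.sqrt (\sum_i \sum_j `|M i j| ^+ 2).

Definition orthonormal_columns (R : realType) (n d : nat) (V : 'M[R]_(n, d)) :
    Prop :=
  V^T *m V = 1%:M.

(** Derivative relative to a set [D]: the increments [h] are restricted to
    those with [h + t \in D]. For [D = `[0, tf]] it is the two-sided derivative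
    at interior points and the one-sided derivative at the endpoints. *)
Definition diff_quotient (R : realType) (V : normedModType R)
    (f : R -> V) (t : R) : R -> V :=
  fun h => h^-1 *: (f (h + t) - f t).

Definition derivable_within (R : realType) (V : normedModType R)
    (D : set R) (f : R -> V) (t : R) : Prop :=
  cvg (diff_quotient f t @ within [set h | D (h + t)] 0^').

Definition derive_within (R : realType) (V : normedModType R)
    (D : set R) (f : R -> V) (t : R) : V :=
  lim (diff_quotient f t @ within [set h | D (h + t)] 0^').

(** Subspaces are row spaces in MathComp, so the column space of [M] is
    represented as the row space of [M^T]. *)
Definition range_mx (F : fieldType) (n k : nat) (M : 'M[F]_(n, k)) : 'M[F]_n :=
  << M^T >>%MS.

Definition krylov (F : fieldType) (n r m : nat)
    (M : 'M[F]_n) (N : 'M[F]_(n, r)) : 'M[F]_n :=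
  range_mx (\mxrow_(j < m) (M ^+ j *m N)).

Definition extended_krylov (F : fieldType) (n r m : nat)
    (M : 'M[F]_n) (N : 'M[F]_(n, r)) : 'M[F]_n :=
  (krylov m M N + krylov m (invmx M) (invmx M *m N))%MS.

(** The shifts are [s 2, ..., s m]; block [j] is the product over
    [2 <= i <= j + 1], which is empty for [j = 0]. *)
Definition rational_krylov (F : fieldType) (n r m : nat)
    (M : 'M[F]_n) (N : 'M[F]_(n, r)) (s : nat -> F) : 'M[F]_n :=
  range_mx (\mxrow_(j < m)
    ((\prod_(2 <= i < j.+2) invmx (M - (s i)%:M)) *m N)).

Definition complexify (R : realType) (m n : nat) (M : 'M[R]_(m, n)) :
    'M[R[i]]_(m, n) :=
  map_mx (real_complex R) M.

(** The shifts of the rational space may be complex, [V] remaining real: [V]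
    then spans the space over the complex numbers. For real shifts this is the
    same as spanning it over the reals. *)
Definition spans_krylov (R : realType) (n r d m : nat)
    (A : 'M[R]_n) (N : 'M[R]_(n, r)) (V : 'M[R]_(n, d)) : Prop :=
  [\/ (range_mx V == krylov m A^T N)%MS,
      (range_mx V == extended_krylov m A^T N)%MS
    | exists s : nat -> R[i],
        (forall i : nat, (2 <= i <= m)%N -> ~~ eigenvalue (complexify A) (s i))
        /\ (range_mx (complexify V) ==
              rational_krylov m (complexify A)^T (complexify N) s)%MS].

Definition riccati_residual (R : realType) (tf : R) (n s p : nat)
    (A : 'M[R]_n) (B : 'M[R]_(n, s)) (C : 'M[R]_(p, n))
    (X : R -> 'M[R]_n) (t : R) : 'M[R]_n :=
  derive_within `[0, tf] X t - A^T *m X t - X t *m A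
    + X t *m B *m B^T *m X t - C^T *m C.

(* Main.v *)
(** Since range(C^T) lies in range(V), [C = C V V^T]; together with the Arnoldi
    relation this gives, writing R^I, R^O for the two reduced residuals,
      [R = V R^I V^T - nu R^O V^T - V (R^O)^T nu^T].
    With respect to the orthonormal columns of [V, nu] these are three distinct
    blocks, so their squared Frobenius norms add up. *)
Require Import Defs.
From HB Require Import structures.
From mathcomp Require Import all_boot all_order all_algebra.
From mathcomp Require Import all_classical all_reals all_analysis.
From mathcomp Require Import complex lra.
Set Implicit Arguments.
Unset Strict Implicit.
Unset Printing Implicit Defensive.
Import Order.TTheory GRing.Theory Num.Theory.
Import numFieldNormedType.Exports.
Local Open Scope classical_set_scope.
Local Open Scope ring_scope.

(** Expanding the argument over the [delta_mx i j] writes [f] as a finite sum of continuous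
    coordinates times fixed vectors. *)
Lemma linear_matrix_continuous (R : numFieldType) (m n : nat)
    (W : normedModType R) (f : {linear 'M[R]_(m, n) -> W}) :
  continuous f.
Proof.
have -> : (f : _ -> _) =
    (fun N => \sum_i \sum_j N i j *: f (delta_mx i j)).
  apply/funext => N; rewrite {1}(matrix_sum_delta N) linear_sum.
  apply: eq_bigr => i _; rewrite linear_sum.
  by apply: eq_bigr => j _; rewrite linearZ.
apply: continuous_big => [|i _]; first exact: add_continuous.
apply: continuous_big => [|j _ M]; first exact: add_continuous.
have Nij := @coord_continuous R m n i j M.
exact: cvgZr_tmp Nij.
Qed.

(** Properness is what makes the limit in [derive_within] unique; it holds because every point of a
    nondegenerate interval, endpoints included, is an accumulation point of it. *)
Lemma within_dnbhs_itv_proper (R : realType) (a b t : R) :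
  a < b -> t \in `[a, b] ->
  ProperFilter (within [set h | `[a, b]%classic (h + t)] 0^').
Proof.
move=> ab; rewrite in_itv /= => /andP[at_ tb].
apply: Build_ProperFilter_ex => P.
rewrite /within /= => /nbhs_ballP[e /= e0 Pe].
have [h [h0 he hab]] : exists h, [/\ h != 0, `|h| < e & a <= h + t <= b].
  (* Step right when there is room; otherwise [t] equals [b], and [a < b] leaves room on the left.
     Halving [e] keeps the step strictly inside the ball. *)
  have [tb'|bt] := ltP t b.
    exists (Num.min (e / 2) (b - t)).
    have h0 : 0 < Num.min (e / 2) (b - t)
      by rewrite lt_min; apply/andP; split; lra.
    have h1 : Num.min (e / 2) (b - t) <= e / 2 by rewrite ge_min lexx.
    have h2 : Num.min (e / 2) (b - t) <= b - t by rewrite ge_min lexx orbT.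
    by split; [rewrite gt_eqF|rewrite gtr0_norm//; lra|apply/andP; split; lra].
  exists (- Num.min (e / 2) (t - a)).
  have h0 : 0 < Num.min (e / 2) (t - a)
      by rewrite lt_min; apply/andP; split; lra.
  have h1 : Num.min (e / 2) (t - a) <= e / 2 by rewrite ge_min lexx.
  have h2 : Num.min (e / 2) (t - a) <= t - a by rewrite ge_min lexx orbT.
  split; [by rewrite oppr_eq0 gt_eqF | rewrite normrN gtr0_norm//; lra |].
  by apply/andP; split; lra.
by exists h; apply: Pe => //=; rewrite /ball /= sub0r normrN.
Qed.

(** A linear map commutes with difference quotients, and a continuous one carries their limit
    along. *)
Lemma derive_within_linear (R : realType) (V W : normedModType R)
    (L : {linear V -> W}) (D : set R) (f : R -> V) (t : R) :
  continuous L -> ProperFilter (within [set h | D (h + t)] 0^') ->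
  derivable_within D f t ->
  derive_within D (L \o f) t = L (derive_within D f t).
Proof.
move=> cL PF df; rewrite /derive_within.
have -> : diff_quotient (L \o f) t = L \o diff_quotient f t.
  by apply/funext => h; rewrite /diff_quotient /= -linearB -linearZ.
apply: cvg_lim; first exact: norm_hausdorff.
by apply: continuous_cvg => //; exact: cL.
Qed.

Lemma sub_range_mxrow (F : fieldType) (n c r m : nat)
    (M : 'M[F]_(c, n)) (K : 'I_m -> 'M[F]_(n, r)) (j : 'I_m) :
  (M <= (K j)^T -> M <= range_mx (\mxrow_(j < m) K j))%MS.
Proof.
move=> /submxP[D ->]; rewrite genmxE.
(* Right multiplication by a block column of the identity selects block [j]. *)
have -> : K j = (\mxrow_j K j) *m submxrow 1%:M j.
  by rewrite mul_submxrow mulmx1 mxrowK.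
by rewrite trmx_mul mulmxA submxMl.
Qed.

Lemma sub_range_orthonormal (R : realType) (n d c : nat) (V : 'M[R]_(n, d))
    (M : 'M[R]_(c, n)) :
  orthonormal_columns V -> (M <= range_mx V)%MS -> M *m V *m V^T = M.
Proof.
move=> oV; rewrite genmxE => /submxP[D ->].
by rewrite -!mulmxA (mulmxA V^T) oV mul1mx.
Qed.

(** In each case block 0, present since [m] is positive, is the generator itself, whose leading
    columns are [N1]. *)
Lemma sub_spans_krylov (R : realType) (n p q d m : nat) (A : 'M[R]_n)
    (N1 : 'M[R]_(n, p)) (N2 : 'M[R]_(n, q)) (V : 'M[R]_(n, d)) :
  (0 < m)%N -> spans_krylov m A (row_mx N1 N2) V -> (N1^T <= range_mx V)%MS.
Proof.
case: m => // m _.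
have N1N : (N1^T <= (row_mx N1 N2)^T)%MS by rewrite tr_row_mx -addsmxE addsmxSl.
case=> [VE|VE|[s [_ VE]]].
- rewrite (eqmxP VE); apply: (sub_range_mxrow (j := ord0)).
  by rewrite expr0 mul1mx.
- rewrite (eqmxP VE); apply: (submx_trans _ (addsmxSl _ _)).
  apply: (sub_range_mxrow (j := ord0)).
  by rewrite expr0 mul1mx.
(* Inclusion is shown over the complex numbers and then descends, since [map_submx] makes it
   invariant under field extension. *)
- have : (map_mx (real_complex R) N1^T <= range_mx (complexify V))%MS.
    rewrite (eqmxP VE); apply: (sub_range_mxrow (j := ord0)).
    by rewrite big_geq// mul1mx map_trmx map_submx.
  by rewrite genmxE map_trmx map_submx genmxE.
Qed.

Lemma frobenius_sqr (R : realType) (m n : nat) (M : 'M[R]_(m, n)) :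
  frobenius M ^+ 2 = \tr (M^T *m M).
Proof.
rewrite sqr_sqrtr; last by do 2!apply: sumr_ge0 => ? _; exact: sqr_ge0.
rewrite exchange_big; apply: eq_bigr => j _ /=; rewrite mxE.
by apply: eq_bigr => i _; rewrite mxE real_normK ?num_real// expr2.
Qed.

Lemma frobenius_block_sqr (R : realType) (n d k : nat) (V : 'M[R]_(n, d))
    (nu : 'M[R]_(n, k)) (S : 'M[R]_d) (O : 'M[R]_(k, d)) :
  orthonormal_columns (row_mx V nu) ->
  frobenius (V *m S *m V^T - nu *m O *m V^T - V *m O^T *m nu^T) ^+ 2 =
    frobenius S ^+ 2 + 2 * frobenius O ^+ 2.
Proof.
rewrite /orthonormal_columns tr_row_mx mul_col_row scalar_mx_block.
move=> /eq_block_mx[VV Vnu nuV nunu].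
rewrite /= in VV Vnu nuV nunu.
(* The left factor [X] lets these four rules fire inside left-associated products. *)
have mVV r (X : 'M[R]_(r, d)) : X *m V^T *m V = X.
  by rewrite -mulmxA VV mulmx1.
have mnunu r (X : 'M[R]_(r, k)) : X *m nu^T *m nu = X.
  by rewrite -mulmxA nunu mulmx1.
have mVnu r (X : 'M[R]_(r, d)) : X *m V^T *m nu = 0.
  by rewrite -mulmxA Vnu mulmx0.
have mnuV r (X : 'M[R]_(r, k)) : X *m nu^T *m V = 0.
  by rewrite -mulmxA nuV mulmx0.
(* [P] gathers the terms with left factor [V]; the remaining term has left factor [nu], so the cross
   terms vanish. *)
pose P := S *m V^T - O^T *m nu^T.
have PP : P *m P^T = S *m S^T + O^T *m O.
  rewrite /P [(_ - _)^T]linearB /= !trmx_mul !trmxK mulmxBr !mulmxBl !mulmxA.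
  by rewrite mVV mVnu mnuV mnunu !mul0mx subr0 sub0r opprK.
have -> : V *m S *m V^T - nu *m O *m V^T - V *m O^T *m nu^T =
    V *m P - nu *m O *m V^T.
  by rewrite mulmxBr !mulmxA addrAC.
rewrite !frobenius_sqr [(_ - _)^T]linearB /= mulmxBr !mulmxBl !trmx_mul.
rewrite !trmxK !mulmxA mVV mVnu mnuV mnunu !mul0mx subr0 sub0r opprK.
(* By cyclicity [PP] applies. The trace of [O^T *m O] comes once from [P] and once from the [nu]
   term, whence the factor 2. *)
rewrite mxtraceD mxtrace_mulC PP mxtraceD [\tr (S *m _)]mxtrace_mulC.
rewrite [\tr (_ *m V^T)]mxtrace_mulC !mulmxA VV mul1mx.
by rewrite -addrA -mulr2n mulr_natl.
Qed.

Theorem proposition4p1 (R : realType) (n s p q d k m : nat) (tf : R)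
    (A : 'M[R]_n) (B : 'M[R]_(n, s)) (C : 'M[R]_(p, n)) (Z : 'M[R]_(n, q))
    (V : 'M[R]_(n, d)) (nu : 'M[R]_(n, k)) (tau : 'M[R]_(d, k))
    (Y : R -> 'M[R]_d)
    (A_unit : A \in unitmx)
    (tf_gt0 : 0 < tf)
    (m_gt0 : (0 < m)%N)
    (V_orthonormal : orthonormal_columns V)
    (V_krylov : spans_krylov m A (row_mx C^T Z) V)
    (Vnu_orthonormal : orthonormal_columns (row_mx V nu))
    (arnoldi : A^T *m V = V *m (V^T *m A *m V)^T + nu *m tau^T)
    (Y_derivable : forall t : R, t \in `[0, tf] -> derivable_within `[0, tf] Y t)
    (Y_sym : forall t : R, t \in `[0, tf] -> (Y t)^T = Y t) :
  let Tm := V^T *m A *m V in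
  let Bm := V^T *m B in
  let Cm := C *m V in
  let Xm := fun t => V *m Y t *m V^T in
  let Rm := riccati_residual tf A B C Xm in
  let RI := riccati_residual tf Tm Bm Cm Y in
  let RO := fun t => tau^T *m Y t in
  forall t : R, t \in `[0, tf] ->
    frobenius (Rm t) ^+ 2 = frobenius (RI t) ^+ 2 + 2 * frobenius (RO t) ^+ 2.
Proof.
move=> Tm Bm Cm Xm Rm RI RO t t0.
have C_V : C *m V *m V^T = C.
  apply: sub_range_orthonormal => //.
  by rewrite -[C]trmxK; exact: sub_spans_krylov V_krylov.
have dX : derive_within `[0, tf] Xm t =
    V *m derive_within `[0, tf] Y t *m V^T.
  apply: (@derive_within_linear _ _ _ (mulmxr V^T \o mulmx V)).
  - exact: linear_matrix_continuous.
  - exact: within_dnbhs_itv_proper.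
  - exact: Y_derivable.
have AX : A^T *m Xm t = V *m (Tm^T *m Y t) *m V^T + nu *m RO t *m V^T.
  by rewrite /Xm /RO !mulmxA arnoldi !mulmxDl.
have XA : Xm t *m A = V *m (Y t *m Tm) *m V^T + V *m (RO t)^T *m nu^T.
  (* Symmetry of [Y t] passes to [Xm t], so this is the transpose of [AX]. *)
  rewrite -[LHS]trmxK trmx_mul.
  have -> : (Xm t)^T = Xm t by rewrite /Xm !trmx_mul trmxK Y_sym// mulmxA.
  by rewrite AX [(_ + _)^T]linearD /RO /= !trmx_mul !trmxK Y_sym// !mulmxA.
have -> : Rm t = V *m RI t *m V^T - nu *m RO t *m V^T - V *m (RO t)^T *m nu^T.
  rewrite /Rm /RI /riccati_residual dX AX XA.
  have -> : C^T *m C = V *m (Cm^T *m Cm) *m V^T.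
    by rewrite -{1 2}C_V !trmx_mul !trmxK !mulmxA.
  have -> : Xm t *m B *m B^T *m Xm t =
      V *m (Y t *m Bm *m Bm^T *m Y t) *m V^T.
    by rewrite /Xm /Bm trmx_mul trmxK !mulmxA.
  rewrite !(mulmxDr, mulmxN, mulmxDl, mulNmx).
  (* With the products abstracted into atoms, the identity is linear and can be checked
     entrywise. *)
  move: (V *m (Tm^T *m Y t) *m V^T) (V *m (Y t *m Tm) *m V^T) => a b.
  move: (V *m derive_within _ Y t *m V^T) => c.
  move: (V *m (_ *m Cm) *m V^T) (V *m (_ *m Y t) *m V^T) => e f.
  move: (nu *m _ *m _) (V *m _ *m nu^T) => g h.
  apply/matrixP => i j; rewrite !mxE; lra.
exact: frobenius_block_sqr.
Qed.
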